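(* For every Parry number $\beta$ whose Parry polynomial $n_\beta^*(X)$ is irreducible, $$\frac{{\rm rp}(n_\beta^* )}{d_P}\leq\sqrt{\frac{2\pi}{k}}\,\sqrt{3\,{\rm Log}(2d_P)+4\,{\rm Log}\,{\rm M}(P_\beta)}\;\frac{1}{\sqrt{d_P}},$$ where $k=\sum_{m\geq0}\frac{(-1)^m}{(2m+1)^2}$ is Catalan's constant.
   Context: For non-integer $\beta>1$, $d_\beta(1)=0.t_1t_2\ldots$ with $t_1=\lfloor\beta\rfloor$, $t_{j+1}=\lfloor\beta T_\beta^j(1)\rfloor$, $T_\beta(x)=\beta x-\lfloor\beta x\rfloor$; $\beta$ is a Parry number if $(t_i)$ is eventually periodic. Parry polynomial: if $t_i=0$ for $i>m$, $t_m\neq0$: $n_\beta^*(X)=X^m-\sum_{i=1}^mt_iX^{m-i}$; otherwise with minimal preperiod $m\ge0$ and period $p+1$: if $m\ge1$, $n_\beta^*(X)=X^{m+p+1}-\sum_{i=1}^{m+p+1}t_iX^{m+p+1-i}-X^m+\sum_{i=1}^mt_iX^{m-i}$; if $m=0$, $n_\beta^*(X)=X^{p+1}-\sum_{i=1}^pt_iX^{p+1-i}-(1+t_{p+1})$; $d_P$ is its degree. $P_\beta$ is the minimal polynomial of $\beta$, ${\rm M}$ the Mahler measure ($|a|\prod_j\max\{1,|b_j|\}$ for $a\prod_j(X-b_j)$), ${\rm Log}$ the natural logarithm, and ${\rm rp}(R)$ the number of real positive roots of $R$ counted with multiplicities. *)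

(* Defs.v *)
From HB Require Import structures.
From mathcomp Require Import all_boot all_order all_algebra.
From mathcomp Require Import complex.
From mathcomp Require Import all_classical all_reals all_analysis.

Set Implicit Arguments.
Unset Strict Implicit.
Unset Printing Implicit Defensive.

Import Order.TTheory GRing.Theory Num.Theory.
Import numFieldNormedType.Exports.

Local Open Scope ring_scope.

Definition beta_map (R : realType) (beta x : R) : R :=
  beta * x - (Num.floor (beta * x))%:~R.

(* Digits are indexed from 1, with t_1 = floor beta (as T^0(1) = 1); the value
   at index 0 is never used. *)
Definition parry_digit (R : realType) (beta : R) (i : nat) : int :=
  Num.floor (beta * iter i.-1 (beta_map beta) 1).

(* The period is p + 1, so that it is automatically positive. *)
Definition eventually_periodic (t : nat -> int) (m p : nat) : Prop :=
  forall i, (m < i)%N -> t (i + p.+1)%N = t i.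

Definition minimal_periodic (t : nat -> int) (m p : nat) : Prop :=
  eventually_periodic t m p /\
  forall m' p', eventually_periodic t m' p' -> (m <= m')%N /\ (p <= p')%N.

Definition parry_number (R : realType) (beta : R) : Prop :=
  [/\ 1 < beta, beta \isn't a Num.int &
      exists m p, eventually_periodic (parry_digit beta) m p].

Definition eventually_zero (t : nat -> int) (m : nat) : Prop :=
  forall i, (m < i)%N -> t i = 0.

Definition parry_poly_finite (t : nat -> int) (m : nat) : {poly int} :=
  'X^m - \sum_(1 <= i < m.+1) (t i)%:P * 'X^(m - i).

Definition parry_poly_mixed (t : nat -> int) (m p : nat) : {poly int} :=
  'X^(m + p.+1) - \sum_(1 <= i < (m + p.+1).+1) (t i)%:P * 'X^(m + p.+1 - i)
  - 'X^m + \sum_(1 <= i < m.+1) (t i)%:P * 'X^(m - i).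

Definition parry_poly_pure (t : nat -> int) (p : nat) : {poly int} :=
  'X^(p.+1) - \sum_(1 <= i < p.+1) (t i)%:P * 'X^(p.+1 - i) - (1 + t p.+1)%:P.

Variant is_parry_poly (R : realType) (beta : R) : {poly int} -> Prop :=
| ParryFinite m of
    (0 < m)%N & eventually_zero (parry_digit beta) m & parry_digit beta m != 0 :
    is_parry_poly beta (parry_poly_finite (parry_digit beta) m)
| ParryMixed m p of
    (forall N, ~ eventually_zero (parry_digit beta) N) &
    minimal_periodic (parry_digit beta) m p & (0 < m)%N :
    is_parry_poly beta (parry_poly_mixed (parry_digit beta) m p)
| ParryPure p of
    (forall N, ~ eventually_zero (parry_digit beta) N) &
    minimal_periodic (parry_digit beta) 0 p :
    is_parry_poly beta (parry_poly_pure (parry_digit beta) p).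

Definition is_min_poly (R : realType) (x : R) (P : {poly rat}) : Prop :=
  [/\ P \is monic, root (map_poly ratr P) x &
      forall Q : {poly rat}, Q != 0 -> root (map_poly ratr Q) x ->
        (size P <= size Q)%N].

(* The multiset of complex roots, as a sequence r such that
   q = lead_coef q *: \prod_(z <- r) ('X - z%:P). *)
Definition croots (R : realType) (q : {poly R[i]}) : seq R[i] :=
  sval (closed_field_poly_normal q).

Definition mahler (R : realType) (P : {poly rat}) : R :=
  let q := map_poly ratr P : {poly R[i]} in
  ComplexField.Normc.normc (lead_coef q) *
  \prod_(z <- croots q) Num.max 1 (ComplexField.Normc.normc z).

Definition rp (R : realType) (P : {poly int}) : nat :=
  count (fun z : R[i] => (complex.Im z == 0) && (0 < complex.Re z))
        (croots (map_poly intr P)).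

Definition catalan (R : realType) : R :=
  limn (series (fun m : nat => (-1) ^+ m / (2 * m + 1)%:R ^+ 2 : R)).

(* Main.v *)
Require Import Defs.
From mathcomp Require Import all_boot all_order all_algebra.
From mathcomp Require Import complex separable polyorder.
From mathcomp Require Import all_classical all_reals all_analysis.
From mathcomp Require Import ring lra zify.
Import Order.TTheory GRing.Theory Num.Theory.
Import numFieldNormedType.Exports.
Local Open Scope ring_scope.

(* When the expansion of 1 is finite or purely periodic, the Parry polynomial
   has a single sign change, hence at most one positive root. In the mixed
   case, [x ^- d * n(x) = (1 - z ^+ p.+1) * (1 - \sum_(i >= 1) t_i z ^+ i)] with
   [z = x^-1] shows that there is at most one root beyond 1, and the roots in
   (0, 1] are counted by duality: applying [x d/dx - c] to a polynomial loses at
   most one of them, by Rolle's theorem for [x^(-c) n(x)], so that if there are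
   more of them than the degree of a real-rooted polynomial [q], then
   [\sum_j a_j q(j) x^j] vanishes for some [x] in (0, 1]. This is impossible
   when [|q(0)|] exceeds [\sum_(j >= 1) |a_j|] and [|q| <= 1] on {1, ..., d}.
   With [r] close to [ln (2 d beta)], such a [q] of degree [O(sqrt (d r))] is the
   product of [r] Chebyshev polynomials, bounded by 1 on [0, d] and vanishing
   respectively at 1, ..., r, and of one Chebyshev polynomial for the interval
   [r, d], which is exponentially large at 0. *)

Set Implicit Arguments.
Unset Strict Implicit.
Unset Printing Implicit Defensive.

(** * Roots in (0, 1] under the operators x d/dx - c *)

Section RootCounting.
Variable R : realType.
Implicit Types (p : {poly R}) (a b c x : R).

Definition euler_op c p : {poly R} := 'X * p^`() - c *: p.

Lemma coef_euler_op c p j : (euler_op c p)`_j = (j%:R - c) * p`_j.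
Proof.
rewrite /euler_op coefB coefZ coefXM coef_deriv.
case: j => [|j] /=; first by rewrite sub0r mulrBl mul0r sub0r.
by rewrite mulrBl mulr_natl.
Qed.

(* Rolle's theorem applied to [x `^ (- c) * p.[x]]. *)
Lemma euler_op_rolle c p a b : 0 < a -> a < b -> p.[a] = 0 -> p.[b] = 0 ->
  exists2 x, a < x < b & (euler_op c p).[x] = 0.
Proof.
move=> a0 ab pa pb; set f := (fun x : R => x `^ (- c) * p.[x]).
have fD x : 0 < x -> is_derive x 1 f
    (x `^ (- c) * p^`().[x] + p.[x] * (- c * x `^ (- c - 1))).
  move=> x0; have D1 := is_derive1_powR (- c) x0.
  have D2 := is_derive_poly p x.
  exact: (is_deriveM D1 D2).
have [||| x] := @Rolle R f a b ab.
- by move=> x; rewrite in_itv/= => /andP[ax _]; case: (fD x (lt_trans a0 ax)).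
- apply: derivable_within_continuous => x; rewrite in_itv/= => /andP[ax _].
  by case: (fD x (lt_le_trans a0 ax)).
- by rewrite /f pa pb !mulr0.
rewrite in_itv/= => axb D; exists x => //.
have x0 : 0 < x by case/andP: axb => /(lt_trans a0).
have [_ e1] := fD x x0; have [_ e2] := D.
have := e1; rewrite e2 => /esym e.
have h : x `^ (- c) = x * x `^ (- c - 1).
  by rewrite -{2}(powRr1 (ltW x0)) -powRD ?(gt_eqF x0) ?implybT//; congr powR; ring.
rewrite h in e; rewrite /euler_op !hornerE.
have /eqP: x `^ (- c - 1) * (x * p^`().[x] - c * p.[x]) = 0.
  by rewrite -e; ring.
by rewrite mulf_eq0 gt_eqF ?powR_gt0//= => /eqP.
Qed.

(** Rolle's theorem is applied between consecutive roots, so exactly one root is given up. The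
    smallest root [a] is kept apart for the induction, and the bounds by [a] and [last a s] both
    keep the new roots sorted and confine them to the original interval. *)
Lemma euler_op_sorted_roots c p a s :
  0 < a -> p.[a] = 0 -> path <%R a s -> all (root p) s ->
  exists t, [/\ size t = size s, sorted <%R t, all (root (euler_op c p)) t
    & all (fun x => (a < x) && (x < last a s)) t].
Proof.
elim: s a => [|b s IH] a a0 pa /=; first by exists [::].
move=> /andP[ab bs] /andP[/rootP pb ps].
have [x /andP[ax xb] px] := euler_op_rolle c a0 ab pa pb.
have [t [sz st rt bt]] := IH b (lt_trans a0 ab) pb bs ps.
have bl : b <= last b s.
  by rewrite le_eqVlt; case: s bs {IH ps sz bt} => [|y s] bs; rewrite ?eqxx//=;
    rewrite (allP (order_path_min lt_trans bs)) ?mem_last ?orbT.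
exists (x :: t); split => /=.
- by rewrite sz.
- case: t {sz rt} st bt => //= y t -> /andP[/andP[by_ _] _].
  by rewrite (lt_trans xb by_).
- by rewrite rt andbT; apply/rootP.
rewrite ax (lt_le_trans xb bl) /=; apply/allP => y /(allP bt) /andP[by_ ->].
by rewrite (lt_trans (lt_trans ax xb) by_).
Qed.

(** Each entry [c] of [s] stands for one application of [euler_op c], which multiplies the
    coefficient of degree j by j - c and costs one root. As [u] is longer than [s], a root survives
    them all. *)
Lemma split_multiplier_root p s (u : seq R) :
  sorted <%R u -> all (root p) u -> all (fun x => 0 < x <= 1) u ->
  (size s < size u)%N ->
  exists2 x, 0 < x <= 1 &
    \sum_(j < size p) p`_j * (\prod_(c <- s) (j%:R - c)) * x ^+ j = 0.
Proof.
elim: s p u => [|c s IH] p [|a u] //= su /andP[pa ru] /andP[a1 u1] sz.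
  exists a => //; under eq_bigr do rewrite big_nil mulr1.
  by rewrite -horner_coef; apply/rootP.
have [a0 _] := andP a1.
have [t [szt st rt bt]] := @euler_op_sorted_roots c p a u a0 (rootP pa) su ru.
have [|| x x1 xE] := IH (euler_op c p) t st rt.
- apply/allP => x /(allP bt) /andP[ax xl]; rewrite (lt_trans a0 ax) /=.
  apply: le_trans (ltW xl) _.
  have : last a u \in a :: u by apply: mem_last.
  rewrite inE => /orP[/eqP ->|/(allP u1)/andP[]//].
  by case/andP: a1.
- by rewrite szt.
exists x => //; rewrite -[RHS]xE.
(* The degree may drop, when [c] equals the degree of [p]; the shorter sum is then padded with zero
   terms. *)
have szL : (size (euler_op c p) <= size p)%N.
  by apply/leq_sizeP => j /(nth_default 0) pj; rewrite coef_euler_op pj mulr0.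
rewrite [RHS](big_ord_widen _ (fun j => (euler_op c p)`_j *
  (\prod_(c <- s) (j%:R - c)) * x ^+ j) szL) [RHS]big_mkcond /=.
apply: eq_bigr => j _; rewrite big_cons coef_euler_op.
case: ltnP => [_|]; first by ring.
move=> /(nth_default 0); rewrite coef_euler_op => e.
by rewrite mulrA [p`_j * _]mulrC e !mul0r.
Qed.

(** With more roots than factors, the transformed polynomial would vanish at some x in (0, 1]. There
    |x ^ j| <= 1, so its constant term outweighs all the others, a contradiction. *)
Lemma split_multiplier_count p s (u : seq R) (q : nat -> R) c0 :
  sorted <%R u -> all (root p) u -> all (fun x => 0 < x <= 1) u ->
  (forall j, q j = c0 * \prod_(c <- s) (j%:R - c)) ->
  (forall j, (0 < j < size p)%N -> `|q j| <= 1) ->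
  \sum_(1 <= j < size p) `|p`_j| < `|p`_0 * q 0%N| ->
  (size u <= size s)%N.
Proof.
move=> su ru u1 qE q1 lt; rewrite leqNgt; apply/negP => sz.
have [x /andP[x0 x1] xE] := @split_multiplier_root p s u su ru u1 sz.
have {xE} : \sum_(0 <= j < size p) p`_j * q j * x ^+ j = 0.
  rewrite big_mkord -[RHS](mulr0 c0) -[X in _ = _ * X]xE mulr_sumr; apply: eq_bigr => j _.
  by rewrite qE; ring.
have sp : (0 < size p)%N.
  by rewrite lt0n; apply: contraTneq lt => /eqP; rewrite size_poly_eq0 => /eqP->;
    rewrite coef0 mul0r normr0 size_poly0 big_geq// ltxx.
rewrite big_ltn// expr0 mulr1 => /eqP; rewrite addr_eq0 => /eqP e.
move: lt; rewrite e normrN; apply/negP; rewrite -leNgt.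
apply: le_trans (ler_norm_sum _ _ _) _; rewrite big_nat [leRHS]big_nat.
apply: ler_sum => j jp; rewrite !normrM normrX (ger0_norm (ltW x0)) -mulrA.
rewrite ler_piMr// mulr_ile1 ?exprn_ge0 ?exprn_ile1 ?q1//; exact: ltW.
Qed.

End RootCounting.

(** * Chebyshev polynomials *)

Section Chebyshev.
Variable R : realType.
Implicit Types (x t w : R) (n : nat).

Fixpoint cheb n : {poly R} :=
  if n is m.+1 then
    if m is k.+1 then (2 *: 'X) * cheb m - cheb k else 'X
  else 1.

Lemma chebSS n : cheb n.+2 = (2 *: 'X) * cheb n.+1 - cheb n.
Proof. by []. Qed.

Lemma cheb_ind (P : nat -> Prop) :
  P 0%N -> P 1%N -> (forall n, P n -> P n.+1 -> P n.+2) -> forall n, P n.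
Proof.
move=> P0 P1 PS n; suff [] : P n /\ P n.+1 by [].
by elim: n => [//|n [Pn PSn]]; split=> //; apply: PS.
Qed.

Lemma cheb_cos n t : (cheb n).[cos t] = cos (n%:R * t).
Proof.
elim/cheb_ind: n => [||n IH1 IH2].
- by rewrite hornerE mul0r cos0.
- by rewrite /= hornerX mul1r.
rewrite chebSS !hornerE IH1 IH2.
have -> : n.+2%:R * t = n.+1%:R * t + t by rewrite [in LHS]mulrSr; ring.
have -> : n%:R * t = n.+1%:R * t - t by rewrite mulrSr; ring.
by rewrite cosB cosD; ring.
Qed.

(** Unlike the cosine formula, this parametrization reaches points beyond 1, where the polynomial
    grows exponentially in [n]. *)
Lemma cheb_joukowski n w : w != 0 ->
  (cheb n).[(w + w^-1) / 2] = (w ^+ n + w ^- n) / 2.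
Proof.
move=> w0; elim/cheb_ind: n => [||n IH1 IH2].
- by rewrite hornerE !expr0 invr1; field.
- by rewrite /= hornerX expr1.
rewrite chebSS !hornerE IH1 IH2 !exprS.
have wn : w ^+ n != 0 by rewrite expf_neq0.
by rewrite /=; field; rewrite w0 wn.
Qed.

Lemma cheb_norm_le1 n x : -1 <= x <= 1 -> `|(cheb n).[x]| <= 1.
Proof. by move=> x1; rewrite -(acosK x1) cheb_cos cos_max. Qed.

Lemma cheb1 n : (cheb n).[1] = 1.
Proof. by rewrite -(cos0 R) cheb_cos mulr0 cos0. Qed.

Lemma size_cheb_le n : (size (cheb n) <= n.+1)%N.
Proof.
elim/cheb_ind: n => [||n IH1 IH2]; first by rewrite size_poly1.
  by rewrite size_polyX.
rewrite chebSS (leq_trans (size_polyD _ _))// size_polyN geq_max.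
rewrite (leq_trans IH1) ?andbT; last by rewrite ltnW.
rewrite -scalerAl (leq_trans (size_scale_leq _ _))//.
by rewrite mulrC (leq_trans (size_polyMleq _ _))// size_polyX addn2.
Qed.

Definition cheb_root n i : R := cos ((2 * i + 1)%:R * (pi / (2 * n%:R))).

Definition cheb_roots n : seq R := [seq cheb_root n i | i <- iota 0 n].

Lemma cheb_roots_root n : all (root (cheb n)) (cheb_roots n).
Proof.
rewrite /cheb_roots all_map; apply/allP => i.
rewrite mem_iota add0n /= => lt_in.
have n0 : n%:R != 0 :> R by rewrite pnatr_eq0 -lt0n (leq_trans _ lt_in).
rewrite rootE cheb_cos; apply/eqP.
have -> : n%:R * ((2 * i + 1)%:R * (pi / (2 * n%:R))) = pi / 2 + i%:R * pi :> R.
  by rewrite natrD natrM; field.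
elim: i {lt_in} => [|i IH]; first by rewrite mul0r addr0 cos_pihalf.
have -> : pi / 2 + i.+1%:R * pi = pi / 2 + i%:R * pi + pi :> R.
  by rewrite mulrSr; ring.
by rewrite cosDpi IH oppr0.
Qed.

Lemma cheb_roots_uniq n : uniq (cheb_roots n).
Proof.
rewrite map_inj_in_uniq ?iota_uniq// => i j; rewrite !mem_iota !add0n /= => lti ltj.
have n0 : 0 < n%:R :> R by rewrite ltr0n (leq_trans _ lti).
have itv k : (k < n)%N -> (2 * k + 1)%:R * (pi / (2 * n%:R)) \in `[0, pi : R].
  move=> kn; rewrite in_itv /= mulr_ge0 ?divr_ge0 ?pi_ge0 ?mulr_ge0 ?(ltW n0)//=.
  rewrite mulrCA ler_piMr ?pi_ge0// ler_pdivrMr ?mulr_gt0// mul1r -natrM ler_nat.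
  by lia.
move=> /(cos_inj (itv _ lti) (itv _ ltj)) /mulIf.
have -> : pi / (2 * n%:R) != 0 :> R.
  by rewrite mulf_neq0 ?invr_eq0 ?mulf_neq0 ?gt_eqF ?pi_gt0.
by move=> /(_ isT) /eqP; rewrite eqr_nat => /eqP; lia.
Qed.

(** The recursion bounds the degree from above. The [n] distinct roots bound it from below, since
    the value 1 at 1 shows that the polynomial is nonzero. *)
Lemma size_cheb n : size (cheb n) = n.+1.
Proof.
apply/eqP; rewrite eqn_leq size_cheb_le /=.
have nz : cheb n != 0.
  by apply/eqP => /(congr1 (horner^~ 1)); rewrite cheb1 horner0; apply/eqP/oner_neq0.
have := max_poly_roots nz (cheb_roots_root n) (cheb_roots_uniq n).
by rewrite size_map size_iota.
Qed.

(** Puts a rescaled Chebyshev polynomial in the factored form that [split_multiplier_count]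
    consumes. *)
Lemma cheb_affine_split n (u v : R) : u != 0 -> exists c s, size s = n /\
  forall x, (cheb n).[u * x + v] = c * \prod_(a <- s) (x - a).
Proof.
move=> u0; exists (lead_coef (cheb n) * u ^+ n), [seq (a - v) / u | a <- cheb_roots n].
split; first by rewrite !size_map size_iota.
move=> x; have -> : cheb n = lead_coef (cheb n) *: \prod_(a <- cheb_roots n) ('X - a%:P).
  apply: all_roots_prod_XsubC; last by rewrite uniq_rootsE cheb_roots_uniq.
    by rewrite size_cheb size_map size_iota.
  exact: cheb_roots_root.
rewrite lead_coefZ (monicP (monic_prod_XsubC _ _ _)) mulr1 hornerZ horner_prod.
have sz : size (cheb_roots n) = n by rewrite size_map size_iota.
rewrite -[X in u ^+ X]sz -mulrA; congr (_ * _) => {sz}.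
elim: (cheb_roots n) => [|a s IH]; first by rewrite !big_nil expr0 mulr1.
rewrite /= !big_cons IH exprS !hornerE /=; field.
exact: u0.
Qed.
End Chebyshev.

(** * Real-rooted multipliers bounded on {1, ..., n} and large at 0 *)

Section Multiplier.
Variable R : realType.
Implicit Types (x : R) (n r K i j : nat).

Lemma sin_le_id x : 0 <= x -> sin x <= x.
Proof.
move=> x0.
have [|c _] := @MVT_segment R sin cos 0 x x0.
  exact/continuous_subspaceT/continuous_sin.
rewrite sin0 !subr0 => ->; rewrite ler_piMl// ; exact: cos_le1.
Qed.

(** With t = pi / 6, the identity cos (2 t) = sin t forces sin t = 1/2, and sin t <= t concludes. *)
Lemma pi_ge3 : 3 <= pi :> R.
Proof.
set t : R := pi / 6.
have t0 : 0 < t by rewrite divr_gt0 ?pi_gt0.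
have ct : 0 < cos t.
  by apply: cos_gt0_pihalf; rewrite /t; have := pi_gt0 R; lra.
have e : cos (t + t) = sin t.
  by rewrite -cosBpihalf -cosN; congr cos; rewrite /t; field.
have s0 : 0 < sin t by apply: sin_gt0_pi; rewrite t0 /t; have := pi_gt0 R; lra.
have e2 : 2 * sin t ^+ 2 + sin t - 1 = 0.
  have h := cos2Dsin2 t.
  have h2 : sin t = cos t ^+ 2 - sin t ^+ 2 by rewrite -{1}e cosD !expr2.
  by lra.
have /eqP : (2 * sin t - 1) * (sin t + 1) = 0 by rewrite -e2; ring.
rewrite mulf_eq0 [sin t + 1 == 0]gt_eqF ?orbF; last by lra.
move=> /eqP s; have := sin_le_id (ltW t0); rewrite /t in s *; lra.
Qed.

(** The affine map sends 0 to 1 and [i] to cos (pi / (2 k)), the largest root of [cheb k]. Its slope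
    is -(1 - cos (2 t)) / i = -2 sin^2 t / i with t = pi / (4 k), small enough for [0, n] to be
    mapped into [-1, 1]. *)
Lemma cheb_vanishing n i k : (0 < n)%N -> (0 < i)%N -> (n <= i * k ^ 2)%N ->
  exists c s, [/\ size s = k, c * \prod_(a <- s) (0 - a) = 1 :> R,
    c * \prod_(a <- s) (i%:R - a) = 0 &
    forall x, 0 <= x <= n%:R -> `|c * \prod_(a <- s) (x - a)| <= 1].
Proof.
move=> n0 i0 nik.
have k0 : (0 < k)%N by case: k nik => //; rewrite muln0 leqNgt n0.
have kR : 0 < k%:R :> R by rewrite ltr0n.
have iR : 0 < i%:R :> R by rewrite ltr0n.
set t : R := pi / (4 * k%:R).
have t0 : 0 < t by rewrite divr_gt0 ?pi_gt0 ?mulr_gt0.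
have tk : t * k%:R <= 1.
  have -> : t * k%:R = pi / 4 by rewrite /t; field; rewrite gt_eqF.
  by have := pihalf_lt2 R; lra.
have k1 : 1 <= k%:R :> R by rewrite ler1n.
have s0 : 0 < sin t.
  apply: sin_gt0_pi; rewrite t0 /= (@le_lt_trans _ _ 1) //.
    by rewrite (le_trans _ tk)// ler_peMr// ltW.
  by have := pi_ge3; lra.
set u : R := - (2 * sin t ^+ 2 / i%:R).
have u0 : u != 0.
  by rewrite oppr_eq0 !mulf_neq0 ?expf_neq0 ?invr_eq0 ?gt_eqF// ltr0n.
have [c [s [sz sE]]] := cheb_affine_split k 1 u0.
exists c, s; split => // [||x /andP[x0 xn]]; rewrite -sE.
- by rewrite mulr0 add0r cheb1.
- have -> : u * i%:R + 1 = cos (t + t).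
    rewrite cosD -!expr2 cos2sin2 /u; field; exact: lt0r_neq0.
  rewrite cheb_cos.
  have -> : k%:R * (t + t) = pi / 2 by rewrite /t; field; rewrite gt_eqF.
  exact: cos_pihalf.
apply: cheb_norm_le1.
suff : 0 <= - (u * x) <= 2 by lra.
rewrite /u mulNr opprK; apply/andP; split.
  by rewrite mulr_ge0 ?divr_ge0 ?mulr_ge0 ?exprn_ge0 ?(ltW s0).
have xik : x <= i%:R * k%:R ^+ 2.
  by rewrite (le_trans xn)// -natrX -natrM ler_nat.
(* From sin t <= t and t k = pi / 4 <= 1. *)
have sk : (sin t * k%:R) ^+ 2 <= 1.
  apply: exprn_ile1; first by rewrite mulr_ge0// ltW.
  by rewrite (le_trans _ tk)// ler_pM2r// sin_le_id// ltW.
apply: (@le_trans _ _ (2 * sin t ^+ 2 / i%:R * (i%:R * k%:R ^+ 2))).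
  by rewrite ler_wpM2l// !mulr_ge0 ?invr_ge0 ?exprn_ge0 ?ltW.
have -> : 2 * sin t ^+ 2 / i%:R * (i%:R * k%:R ^+ 2) = 2 * (sin t * k%:R) ^+ 2.
  by field; rewrite gt_eqF.
by lra.
Qed.

Lemma cheb_vanishing_prod n r (k : nat -> nat) : (0 < n)%N ->
  (forall i, (i < r)%N -> (n <= i.+1 * k i ^ 2)%N) ->
  exists c s, [/\ size s = (\sum_(i < r) k i)%N,
    c * \prod_(a <- s) (0 - a) = 1 :> R,
    forall i, (0 < i <= r)%N -> c * \prod_(a <- s) (i%:R - a) = 0 &
    forall x, 0 <= x <= n%:R -> `|c * \prod_(a <- s) (x - a)| <= 1].
Proof.
move=> n0; elim: r => [|r IH] kP.
  exists 1, [::]; split=> [||[|i]|x _] //; first by rewrite big_ord0.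
    by rewrite big_nil mulr1.
  by rewrite big_nil mulr1 normr1.
have [i ir|c [s [sz s0 si s1]]] := IH; first by apply: kP; rewrite ltnS ltnW.
have [c' [s' [sz' s0' si' s1']]] := cheb_vanishing n0 (ltn0Sn r) (kP _ (leqnn _)).
have E x : c * c' * \prod_(a <- s ++ s') (x - a) =
    (c * \prod_(a <- s) (x - a)) * (c' * \prod_(a <- s') (x - a)).
  by rewrite big_cat /=; ring.
exists (c * c'), (s ++ s'); split.
- by rewrite size_cat sz sz' big_ord_recr.
- by rewrite E s0 s0' mulr1.
- move=> i /andP[i0]; rewrite leq_eqVlt => /orP[/eqP ->|ir].
    by rewrite E si' mulr0.
  by rewrite E si ?mul0r// i0.
move=> x x1; rewrite E normrM mulr_ile1 ?s1 ?s1'//.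
Qed.

(** The interval [r, n] is mapped onto [-1, 1] with reversed orientation, so that 0 goes to (n + r)
    / (n - r) > 1. This is (w + 1/w) / 2 for w = (1 + p) / (1 - p) and p = sqrt (r / n), and w is at
    least exp p. *)
Lemma cheb_boost n r K : (0 < r < n)%N -> exists c s, [/\ size s = K,
    expR (K%:R * Num.sqrt (r%:R / n%:R)) / 2 <= c * \prod_(a <- s) (0 - a) :> R &
    forall x, r%:R <= x <= n%:R -> `|c * \prod_(a <- s) (x - a)| <= 1].
Proof.
move=> /andP[r0 rn].
have rR : 0 < r%:R :> R by rewrite ltr0n.
have nR : r%:R < n%:R :> R by rewrite ltr_nat.
have nr0 : n%:R - r%:R != 0 :> R by rewrite subr_eq0 gt_eqF.
have n0 : n%:R != 0 :> R by rewrite gt_eqF// (lt_trans rR).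
set u : R := - (2 / (n%:R - r%:R)).
have u0 : u != 0 by rewrite oppr_eq0 mulf_neq0 ?invr_eq0.
have [c [s [sz sE]]] := cheb_affine_split K ((n%:R + r%:R) / (n%:R - r%:R)) u0.
exists c, s; split => // [|x /andP[rx xn]]; rewrite -sE.
  set p : R := Num.sqrt _.
  have p0 : 0 < p by rewrite sqrtr_gt0 divr_gt0 // (lt_trans rR).
  have p2 : p ^+ 2 = r%:R / n%:R by rewrite sqr_sqrtr// divr_ge0.
  have p1 : p < 1.
    by rewrite -sqrtr1 ltr_sqrt// ltr_pdivrMr ?mul1r// (lt_trans rR).
  have q0 : 1 - p != 0 by rewrite subr_eq0 gt_eqF.
  have q1 : 1 + p != 0 by rewrite gt_eqF//; lra.
  set w := (1 + p) / (1 - p).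
  have w0 : w != 0 by rewrite mulf_neq0 ?invr_eq0.
  have -> : u * 0 + (n%:R + r%:R) / (n%:R - r%:R) = (w + w^-1) / 2.
    have -> : r%:R = n%:R * p ^+ 2 :> R by rewrite p2; field.
    have q2 : 1 - p ^+ 2 != 0 by rewrite -[1](expr1n _ 2) subr_sqr mulf_neq0.
    rewrite mulr0 add0r /w; field.
    by rewrite q0 q1 -[X in X - _]mulr1 -mulrBr mulf_neq0.
  rewrite cheb_joukowski// ler_pM2r ?invr_gt0//.
  rewrite mulrC expRM_natr.
  (* Indeed (1 - p) exp p <= 1 <= 1 + p. *)
  have wp : expR p <= w.
    have h := expR_ge1Dx (- p); rewrite expRN in h.
    have e0 := expR_gt0 p.
    have : (1 - p) * expR p <= 1.
      by rewrite -(@ler_pM2r _ (expR p)^-1) ?invr_gt0// mul1r mulfK ?gt_eqF.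
    rewrite /w ler_pdivlMr ?subr_gt0// mulrC => h2; lra.
  apply: (@le_trans _ _ (w ^+ K)).
    by rewrite lerXn2r// nnegrE ltW ?expR_gt0// (lt_le_trans (expR_gt0 p)).
  by rewrite lerDl invr_ge0 exprn_ge0// (le_trans (expR_ge0 p)).
apply: cheb_norm_le1.
have -> : u * x + (n%:R + r%:R) / (n%:R - r%:R)
    = (n%:R + r%:R - 2 * x) / (n%:R - r%:R) by rewrite /u; field.
by rewrite ler_pdivlMr ?ler_pdivrMr ?subr_gt0//; lra.
Qed.

(** The boosting factor is uncontrolled at 1, ..., r, but the vanishing factors kill these points;
    on r + 1, ..., n both factors are bounded by 1. *)
Lemma split_multiplier_exists n r K (k : nat -> nat) : (0 < r < n)%N ->
  (forall i, (i < r)%N -> (n <= i.+1 * k i ^ 2)%N) ->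
  exists c s, [/\ size s = (\sum_(i < r) k i + K)%N,
    forall j, (0 < j <= n)%N -> `|c * \prod_(a <- s) (j%:R - a)| <= 1 &
    expR (K%:R * Num.sqrt (r%:R / n%:R)) / 2
      <= `|c * \prod_(a <- s) (0 - a)| :> R].
Proof.
move=> rn kP; have n0 : (0 < n)%N by case/andP: rn => r0 /ltnW; apply: leq_trans.
have [c [s [sz s0 si s1]]] := cheb_vanishing_prod n0 kP.
have [c' [s' [sz' s0' s1']]] := cheb_boost K rn.
have E x : c * c' * \prod_(a <- s ++ s') (x - a) =
    (c * \prod_(a <- s) (x - a)) * (c' * \prod_(a <- s') (x - a)).
  by rewrite big_cat /=; ring.
exists (c * c'), (s ++ s'); split.
- by rewrite size_cat sz sz'.
- move=> j /andP[j0 jn]; rewrite E.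
  have [jr|rj] := leqP j r; first by rewrite si ?j0// mul0r normr0.
  rewrite normrM mulr_ile1 ?s1 ?s1' ?ler_nat ?jn ?ler0n//.
  by rewrite (ltnW rj).
by rewrite E s0 mul1r (le_trans s0')// ler_norm.
Qed.

End Multiplier.

(** * Explicit bound for the number of roots in (0, 1] *)

Section SmallRoots.
Variable R : realType.
Implicit Types (L x : R) (n r : nat).

(** From 1 - 1/6 <= exp (-1/6) one gets exp (1/6) <= 6/5, and (6/5)^6 < 3. *)
Lemma expR1_le3 : expR 1 <= 3 :> R.
Proof.
have h := expR_ge1Dx (- (6^-1) : R); rewrite expRN in h.
have e0 := expR_gt0 (6^-1 : R).
have e65 : expR 6^-1 <= 6 / 5 :> R.
  have : (5 / 6) * expR 6^-1 <= 1 :> R.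
    rewrite -(@ler_pM2r _ (expR 6^-1)^-1) ?invr_gt0// mul1r mulfK ?gt_eqF//.
    by lra.
  by lra.
have -> : 1 = 6^-1 * 6%:R :> R by field.
rewrite expRM_natr (@le_trans _ _ ((6 / 5) ^+ 6))//.
  by rewrite lerXn2r// nnegrE ?ltW//; lra.
by lra.
Qed.

Lemma ln_ge_nat L n : 3 ^+ n <= L -> n%:R <= ln L.
Proof.
move=> h; have L0 : 0 < L by rewrite (lt_le_trans _ h)// exprn_gt0.
rewrite -ler_expR lnK// (le_trans _ h)// -[n%:R]mul1r expRM_natr.
by rewrite lerXn2r ?nnegrE ?expR_ge0// expR1_le3.
Qed.

Lemma ln_ge_half L : 2 <= L -> 2^-1 <= ln L.
Proof.
move=> h; rewrite -ler_expR lnK; last by rewrite posrE; lra.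
have h1 := expR_ge1Dx (- (2^-1) : R); rewrite expRN in h1.
have e0 := expR_gt0 (2^-1 : R).
have : 2^-1 * expR 2^-1 <= 1 :> R.
  rewrite -(@ler_pM2r _ (expR 2^-1)^-1) ?invr_gt0// mul1r mulfK ?gt_eqF//.
  by lra.
by lra.
Qed.

(** Bootstrapping with L >= 36 ln L: the lower bounds 1/2, 2, 3 for ln L give L >= 18, 72, 108,
    which exceed 3^2, 3^3, 3^4 in turn. *)
Lemma ln_ge4 L x : 2 <= L -> 2 * x <= L -> 18 * ln L <= x -> 4 <= ln L.
Proof.
move=> L2 Lx xL.
have h0 := ln_ge_half L2.
have h1 : 2%:R <= ln L by apply: ln_ge_nat; lra.
have h2 : 3%:R <= ln L by apply: ln_ge_nat; lra.
by apply: (@ln_ge_nat L 4); lra.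
Qed.

(** Telescoping, by 1 / sqrt (r + 1) <= 2 (sqrt (r + 1) - sqrt r). *)
Lemma sum_inv_sqrt_le r :
  \sum_(i < r) (Num.sqrt i.+1%:R)^-1 <= 2 * Num.sqrt r%:R :> R.
Proof.
elim: r => [|r IH]; first by rewrite big_ord0 sqrtr0 mulr0.
rewrite big_ord_recr /=.
set a := Num.sqrt r.+1%:R; set b := Num.sqrt r%:R in IH *.
have a0 : 0 < a by rewrite sqrtr_gt0 ltr0n.
have b0 : 0 <= b by apply: sqrtr_ge0.
have e : a ^+ 2 = b ^+ 2 + 1 by rewrite !sqr_sqrtr ?ler0n// mulrSr.
have : a^-1 <= 2 * (a - b).
  by rewrite -div1r ler_pdivrMr//; nra.
by lra.
Qed.

(** The multiplier is built with r the integer part of ln L and has degree O(sqrt (n ln L)). The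
    successor in the conclusion leaves room for one further root, beyond 1. *)
Lemma small_root_count (p : {poly R}) n L (u : seq R) :
  size p = n.+1 -> 1 <= `|p`_0| -> \sum_(1 <= j < size p) `|p`_j| < L ->
  4 <= ln L -> 18 * ln L <= n%:R ->
  sorted <%R u -> all (root p) u -> all (fun x => 0 < x <= 1) u ->
  (size u).+1%:R ^+ 2 <= 18 * n%:R * ln L.
Proof.
move=> szp p0 pL L4 nL su ru u1; set l2 := ln L in L4 nL *.
have L0 : 0 < L by apply: le_lt_trans pL; apply: sumr_ge0.
set r := Num.truncn l2.
have /andP[rl lr] : r%:R <= l2 < r.+1%:R by apply: truncn_itv; lra.
rewrite -natr1 in lr.
have r0 : (0 < r)%N by rewrite truncn_gt0; lra.
have rn : (r < n)%N by rewrite -(ltr_nat R); lra.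
have nR : 0 < n%:R :> R by lra.
have rR : 0 < r%:R :> R by rewrite ltr0n.
set a := Num.sqrt n%:R : R; set b := Num.sqrt r%:R : R; set l := Num.sqrt l2.
have a0 : 0 < a by rewrite sqrtr_gt0.
have b0 : 0 < b by rewrite sqrtr_gt0.
have l0 : 0 < l by rewrite sqrtr_gt0; lra.
have ae : a ^+ 2 = n%:R by rewrite sqr_sqrtr// ltW.
have be : b ^+ 2 = r%:R by rewrite sqr_sqrtr// ltW.
have le : l ^+ 2 = l2 by rewrite sqr_sqrtr//; lra.
have sqrt_div i : Num.sqrt (n%:R / i.+1%:R) = a / Num.sqrt i.+1%:R :> R.
  by rewrite sqrtrM ?sqrtrV// ltW.
(* Essentially the least degree that [cheb_vanishing] allows for a zero at i + 1. *)
pose k i := (Num.truncn (Num.sqrt (n%:R / i.+1%:R) : R)).+1.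
have kP i : (i < r)%N -> (n <= i.+1 * k i ^ 2)%N.
  move=> _; rewrite -(ler_nat R) natrM natrX mulrC -ler_pdivrMr ?ltr0n//.
  rewrite -(@ler_sqrt _ _ (_ ^+ 2)) ?exprn_ge0// sqrtr_sqr ger0_norm//.
  exact/ltW/truncnS_gt.
have kle i : (k i)%:R <= a / Num.sqrt i.+1%:R + 1.
  by rewrite /k -sqrt_div -natr1 lerD2r truncn_le sqrtr_ge0.
(* Chosen so that K sqrt (r / n) >= ln L + 1 >= ln (2 L): half of the exponential in [cheb_boost] is
   then at least [L]. *)
pose K := (Num.truncn ((l2 + 1) * a / b)).+1.
have KP : (l2 + 1) * a / b < K%:R by apply: truncnS_gt.
have Kle : K%:R <= (l2 + 1) * a / b + 1.
  rewrite /K -natr1 lerD2r truncn_le !mulr_ge0 ?invr_ge0 ?ltW//; lra.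
have [||c [s [sz s1 s0]]] := @split_multiplier_exists R n r K k; rewrite ?r0//.
have cnt : (size u <= size s)%N.
  apply: (@split_multiplier_count R p s u
    (fun j => c * \prod_(a <- s) (j%:R - a)) c) => //.
    by move=> j; rewrite szp ltnS; apply: s1.
  apply: lt_le_trans pL _; rewrite normrM.
  apply: (@le_trans _ _ (1 * `|c * \prod_(a <- s) (0 - a)|)); last first.
    by rewrite ler_wpM2r.
  rewrite mul1r (le_trans _ s0)// ler_pdivlMr//.
  have -> : L * 2 = expR (l2 + ln 2).
    by rewrite expRD !lnK// posrE.
  rewrite ler_expR.
  have ln21 : ln 2 <= 1 :> R by have := @le_ln1Dx R 1; rewrite -natr1; apply; lra.
  have -> : Num.sqrt (r%:R / n%:R) = b / a.
    by rewrite sqrtrM ?sqrtrV// ltW.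
  apply: (@le_trans _ _ ((l2 + 1) * a / b * (b / a))); last first.
    by rewrite ler_wpM2r ?ltW// divr_gt0.
  have -> : (l2 + 1) * a / b * (b / a) = l2 + 1.
    by field; rewrite !gt_eqF.
  by lra.
(* The first two terms bound the sum of the [k i], with [r] paying for the rounding; the last bounds
   [K]. *)
have {cnt} : (size u)%:R <= 2 * a * b + r%:R + ((l2 + 1) * a / b + 1).
  apply: (@le_trans _ _ (size s)%:R); first by rewrite ler_nat.
  rewrite sz natrD lerD// natr_sum.
  apply: (@le_trans _ _ (\sum_(i < r) (a / Num.sqrt i.+1%:R + 1))).
    exact: ler_sum.
  rewrite big_split /= sumr_const card_ord lerD2r -mulr_sumr.
  have -> : 2 * a * b = a * (2 * b) by ring.
  by rewrite ler_wpM2l ?(ltW a0)// sum_inv_sqrt_le.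
rewrite -natr1; set N := (size u)%:R => hN.
have N0 : 0 <= N by rewrite ler0n.
(* Every term is now compared with a l = sqrt (n ln L). The coefficients 2, 29/20, 5/21 and 1/8 add
   up to less than 21/5, and (21/5)^2 <= 18. *)
have bl : b <= l by rewrite ler_sqrt//; lra.
have al : 21 / 5 * l <= a.
  rewrite -(@ler_pXn2r _ 2) ?nnegrE ?mulr_ge0 ?ltW// exprMn le ae; lra.
(* Squared, this follows from r > ln L - 1 and ln L >= 4; the margin is small at ln L = 4. *)
have lb : l2 + 1 <= 29 / 20 * l * b.
  rewrite -(@ler_pXn2r _ 2) ?nnegrE ?mulr_ge0 ?ltW//; last by lra.
  rewrite !exprMn le be; nra.
have h1 : (l2 + 1) * a / b <= 29 / 20 * (a * l).
  by rewrite ler_pdivrMr//; nra.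
have h2 : r%:R <= 5 / 21 * (a * l).
  apply: le_trans rl _; rewrite -le; nra.
have h3 : 2 <= 1 / 8 * (a * l) by nra.
have h4 : 2 * a * b <= 2 * (a * l) by nra.
have h5 : N + 1 <= 21 / 5 * (a * l) by lra.
have -> : 18 * n%:R * l2 = 18 * (a * l) ^+ 2 by rewrite exprMn ae le mulrA.
have : (N + 1) ^+ 2 <= (21 / 5 * (a * l)) ^+ 2.
  rewrite lerXn2r ?nnegrE//; [lra|].
  by rewrite !mulr_ge0// ltW.
have := sqr_ge0 (a * l); rewrite exprMn; lra.
Qed.

End SmallRoots.

(** * Bounds for Catalan's constant *)

Section Catalan.
Variable R : realType.

Let b (m : nat) : R := (2 * m + 1)%:R ^- 2.
Let a (m : nat) : R := (-1) ^+ m / (2 * m + 1)%:R ^+ 2.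

Let b_ge0 m : 0 <= b m.
Proof. by rewrite invr_ge0 exprn_ge0. Qed.

Let b_dec m : b m.+1 <= b m.
Proof.
rewrite lef_pV2 ?posrE ?exprn_gt0 ?ltr0n ?addn1// lerXn2r ?nnegrE ?ler0n//.
by rewrite ler_nat; lia.
Qed.

Lemma catalan_series_cvg : cvgn (series a).
Proof.
apply: normed_cvg.
have -> : [normed series a] = series b.
  apply/funext => n; apply: eq_bigr => m _.
  by rewrite /= /a /b normrM normrX normrN1 expr1n mul1r ger0_norm// b_ge0.
apply: nondecreasing_is_cvgn.
  exact/nondecreasing_series.
exists 4 => _ [n _ <-]; rewrite /series /=.
(* This sharper bound is inductive: with x = 2 n + 1, the new term 1 / x^2 is at most 2 / x - 2 / (x
   + 2). *)
apply: (@le_trans _ _ (4 - 2 / (2 * n + 1)%:R)); last by rewrite gerBl divr_ge0.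
elim: n => [|n IH]; first by rewrite big_geq// muln0 add0n divr1; lra.
rewrite big_nat_recr//= /b.
have -> : (2 * n.+1 + 1)%:R = (2 * n + 1)%:R + 2 :> R by rewrite -natrD; congr _%:R; lia.
set x : R := (2 * n + 1)%:R in IH *.
have x1 : 1 <= x by rewrite ler1n addn1.
have x0 : 0 < x by lra.
have : x ^- 2 <= 2 / x - 2 / (x + 2).
  have -> : 2 / x - 2 / (x + 2) = x ^- 2 * (4 * x / (x + 2)).
    by field; rewrite !gt_eqF//; lra.
  rewrite ler_peMr ?invr_ge0 ?exprn_ge0 ?(ltW x0)//.
  by rewrite ler_pdivlMr; lra.
by lra.
Qed.

Let aD m : series a m.+1 = series a m + (-1) ^+ m * b m.
Proof. by rewrite /series /= big_nat_recr. Qed.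

(** Leibniz's alternating argument: sums of even length increase from 1 - 1/9, those of odd length
    decrease from 1. *)
Let catalan_partial n : 8 / 9 <= series a (2 * n + 2)%N /\ series a (2 * n + 1)%N <= 1.
Proof.
have s1 : series a 1 = 1 by rewrite /series /= big_nat1 /a expr0; field.
elim: n => [|n [IH1 IH2]].
  split; last by rewrite muln0 add0n s1.
  by rewrite muln0 add0n aD s1 /b expr1 muln1 addn1; lra.
have e m : (-1) ^+ (2 * m)%N = 1 :> R by rewrite exprM sqrrN !expr1n.
split.
  have -> : (2 * n.+1 + 2 = (2 * n.+1).+2)%N by lia.
  rewrite (aD (2 * n.+1)%N.+1) (aD (2 * n.+1)%N) exprS e !mulN1r mul1r.
  have -> : (2 * n.+1 = 2 * n + 2)%N by lia.
  by have := b_dec (2 * n + 2)%N; lra.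
have -> : (2 * n.+1 + 1 = (2 * n.+1).+1)%N by lia.
rewrite (aD (2 * n.+1)%N) e mul1r.
have -> : (2 * n.+1 = (2 * n + 1).+1)%N by lia.
rewrite (aD (2 * n + 1)%N) addn1 exprS e !mulN1r.
by have := b_dec (2 * n)%N.+1; rewrite addn1 in IH2; lra.
Qed.

(** The upper bound will give 2 pi / k >= 6, the lower one the positivity of k. *)
Lemma catalan_itv : 8 / 9 <= catalan R <= 1.
Proof.
have e m : (-1) ^+ (2 * m)%N = 1 :> R by rewrite exprM sqrrN !expr1n.
have bnd n : 8 / 9 <= series a n.+2 <= 1.
  have [] := catalan_partial n./2; have [_] := catalan_partial n./2.+1.
  have := b_ge0 (2 * n./2 + 2)%N; have := b_ge0 (2 * n./2 + 1)%N.
  have := odd_double_half n; rewrite -mul2n; set k := n./2.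
  case: (odd n) => /= nE.
    have -> : (n.+2 = (2 * k.+1).+1)%N by lia.
    have -> : (2 * k + 2 = 2 * k.+1)%N by lia.
    have -> : (2 * k.+1 + 1 = (2 * k.+1).+1)%N by lia.
    rewrite (aD (2 * k.+1)%N) e; lra.
  have -> : (n.+2 = (2 * k + 1).+1)%N by lia.
  have -> : (2 * k + 2 = (2 * k + 1).+1)%N by lia.
  have -> : (2 * k.+1 + 1 = (2 * k + 1).+2)%N by lia.
  rewrite (aD (2 * k + 1)%N.+1) (aD (2 * k + 1)%N) addn1 !exprS e; lra.
apply/andP; split.
  apply: limr_ge; first exact: catalan_series_cvg.
  by exists 2 => // -[|[|n]] //= _; case/andP: (bnd n).
apply: limr_le; first exact: catalan_series_cvg.
by exists 2 => // -[|[|n]] //= _; case/andP: (bnd n).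
Qed.

End Catalan.

(** * Digits, coefficients and positive roots of Parry polynomials *)

Section ParryPolynomial.
Variable R : realType.
Implicit Types (beta x y z : R) (t : nat -> int) (m p i j : nat).

Lemma beta_orbit_itv beta i : 0 <= iter i (beta_map beta) 1 <= 1.
Proof.
elim: i => [|i _]; first by rewrite /= ler01 lexx.
rewrite iterS /beta_map subr_ge0 floor_le_tmp lerBlDr addrC.
by rewrite -[X in _ + X]/(1%:~R) -intrD ltW// floorD1_gt.
Qed.

Lemma parry_digit_itv beta i : 1 < beta ->
  0 <= parry_digit beta i /\ (parry_digit beta i)%:~R <= beta.
Proof.
move=> b1; have b0 : 0 <= beta by lra.
have /andP[x0 x1] := beta_orbit_itv beta i.-1.
split; first by rewrite floor_ge0 mulr_ge0.
by rewrite (le_trans (floor_le_tmp _))// ler_piMr.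
Qed.

Lemma parry_digit1_gt0 beta : 1 < beta -> 0 < parry_digit beta 1.
Proof.
move=> b1; rewrite /parry_digit /= mulr1.
have : 1 <= Num.floor beta by rewrite floor_ge_int ltW.
by lia.
Qed.

(** Indexing the digit sum by the exponent makes its coefficients directly readable. *)
Definition digit_poly t d : {poly int} := \poly_(j < d) t (d - j)%N.

Lemma digit_sumE t d :
  \sum_(1 <= i < d.+1) (t i)%:P * 'X^(d - i) = digit_poly t d.
Proof.
rewrite /digit_poly poly_def big_add1 big_nat_rev /= -(big_mkord xpredT
  (fun j => t (d - j)%N *: 'X^j)).
apply: eq_big_nat => j /andP[_ jd]; rewrite mul_polyC add0n.
by congr (t _ *: 'X^_); lia.
Qed.

Lemma parry_finiteE t d : parry_poly_finite t d = 'X^d - digit_poly t d.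
Proof. by rewrite /parry_poly_finite digit_sumE. Qed.

Lemma parry_mixedE t m p : parry_poly_mixed t m p =
  'X^(m + p.+1) - digit_poly t (m + p.+1) - 'X^m + digit_poly t m.
Proof. by rewrite /parry_poly_mixed !digit_sumE. Qed.

(** Raising the last digit by one reduces the purely periodic case to the finite one. *)
Lemma parry_pureE t p : parry_poly_pure t p =
  parry_poly_finite (fun i => if i == p.+1 then 1 + t i else t i) p.+1.
Proof.
rewrite /parry_poly_finite big_nat_recr//= eqxx subnn expr0 mulr1.
rewrite /parry_poly_pure opprD addrA; congr (_ - _ - _).
apply: eq_big_nat => i /andP[_ ip].
by rewrite (ltn_eqF ip).
Qed.

Lemma horner_digit_poly t d x : x != 0 -> (map_poly intr (digit_poly t d)).[x] =
  x ^+ d * \sum_(1 <= i < d.+1) (t i)%:~R * x^-1 ^+ i.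
Proof.
move=> x0; rewrite -digit_sumE rmorph_sum horner_sum mulr_sumr.
apply: eq_big_nat => i /andP[_ id].
rewrite rmorphM /= map_polyC map_polyXn hornerCM hornerXn mulrCA.
congr (_ * _); rewrite exprVn -[in RHS](@subnK i d) ?exprD ?mulfK//.
by rewrite expf_neq0.
Qed.

(** There is no constant term, and y ^ i <= (y / x) x ^ i for i >= 1. This is a quantitative form of
    monotonicity. *)
Lemma digit_series_scale t d x y : (forall i, (0 < i <= d)%N -> 0 <= t i) ->
  0 <= y -> y <= x -> 0 < x ->
  \sum_(1 <= i < d.+1) (t i)%:~R * y ^+ i
    <= y / x * \sum_(1 <= i < d.+1) (t i)%:~R * x ^+ i.
Proof.
move=> t0 y0 yx x0; rewrite mulr_sumr big_nat [leRHS]big_nat.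
apply: ler_sum => -[//|i] id; rewrite mulrCA.
apply: ler_wpM2l; first by rewrite ler0z t0.
rewrite !exprS mulrA divfK ?gt_eqF// ler_wpM2l//.
by rewrite lerXn2r// nnegrE ltW.
Qed.

(** In the variable z = 1 / x the equation says that the sum of the t_i z ^ i equals 1, and by
    [digit_series_scale] this happens for at most one z > 0. *)
Lemma parry_finite_root_uniq t d x y : (forall i, (0 < i <= d)%N -> 0 <= t i) ->
  0 < x -> 0 < y ->
  root (map_poly intr (parry_poly_finite t d)) x ->
  root (map_poly intr (parry_poly_finite t d)) y -> x = y.
Proof.
move=> t0; wlog xy : x y / x < y => [W x0 y0 rx ry|].
  by have [/W->|/W->|] := ltgtP x y.
move=> x0 y0.
have E (z : R) : 0 < z -> root (map_poly intr (parry_poly_finite t d)) z ->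
    \sum_(1 <= i < d.+1) (t i)%:~R * z^-1 ^+ i = 1.
  move=> z0; have zd : z ^+ d != 0 by rewrite expf_neq0// gt_eqF.
  rewrite parry_finiteE rmorphB /= map_polyXn rootE hornerD hornerN hornerXn.
  rewrite (horner_digit_poly _ _ (lt0r_neq0 z0)) subr_eq0 => /eqP.
  by rewrite -{1}[z ^+ d]mulr1 => /(mulfI zd) <-.
move=> /(E _ x0) Ex /(E _ y0) Ey; exfalso.
have vxy : y^-1 < x^-1 by rewrite ltf_pV2.
have vy : 0 < y^-1 by rewrite invr_gt0.
have : \sum_(1 <= i < d.+1) (t i)%:~R * y^-1 ^+ i
    <= y^-1 / x^-1 * \sum_(1 <= i < d.+1) (t i)%:~R * x^-1 ^+ i.
  exact: (digit_series_scale t0 (ltW vy) (ltW vxy) (lt_trans vy vxy)).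
rewrite Ex Ey mulr1 ler_pdivlMr ?invr_gt0// mul1r leNgt vxy //.
Qed.

(** For z = 1 / x in (0, 1) the equation reads (1 - z ^ (p + 1)) (1 - B z) = C z, with [B] and [C]
    the sums over the preperiod and over the period. At a solution X both factors on the left are
    nonnegative, so at any smaller Y the left side is strictly larger, as t_1 > 0, while C Y <= C
    X. *)
Lemma parry_mixed_root_gt1_uniq t m p x y : (forall i, 0 <= t i) ->
  0 < t 1 -> (0 < m)%N -> 1 < x -> 1 < y ->
  root (map_poly intr (parry_poly_mixed t m p)) x ->
  root (map_poly intr (parry_poly_mixed t m p)) y -> x = y.
Proof.
move=> t0 t1 m0; wlog xy : x y / x < y => [W x0 y0 rx ry|].
  by have [/W->|/W->|] := ltgtP x y.
move=> x1 y1.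
pose B (z : R) : R := \sum_(1 <= i < m.+1) (t i)%:~R * z ^+ i.
pose C (z : R) : R := \sum_(m.+1 <= i < (m + p.+1).+1) (t i)%:~R * z ^+ i.
have E (z : R) : 1 < z -> root (map_poly intr (parry_poly_mixed t m p)) z ->
    (1 - z^-1 ^+ p.+1) * (1 - B z^-1) = C z^-1.
  move=> z1; have z0 : z != 0 by rewrite gt_eqF//; lra.
  rewrite parry_mixedE rootE => /eqP.
  rewrite !(rmorphD, rmorphN) /= !map_polyXn !(hornerD, hornerN) !hornerXn.
  rewrite !horner_digit_poly// (@big_cat_nat _ _ _ m.+1)//=; last first.
    by rewrite ltnS leq_addr.
  rewrite -/(B _) -/(C _) exprD exprVn => h.
  have zp : z ^+ p.+1 != 0 by rewrite expf_neq0.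
  have zm : z ^+ m != 0 by rewrite expf_neq0.
  apply/eqP; rewrite -subr_eq0.
  have : z ^+ m * z ^+ p.+1 * ((1 - z ^- p.+1) * (1 - B z^-1) - C z^-1) = 0.
    by rewrite -[RHS]h; field.
  by move=> /eqP; rewrite mulf_eq0 mulf_eq0 (negPf zm) (negPf zp).
move=> /(E _ x1) Ex /(E _ y1) Ey; exfalso.
have vxy : y^-1 < x^-1 by rewrite ltf_pV2// posrE; lra.
have vy : 0 < y^-1 by rewrite invr_gt0; lra.
have vx : x^-1 < 1 by rewrite invf_lt1; lra.
move: Ex Ey; set X := x^-1 in vxy vx *; set Y := y^-1 in vxy vy * => Ex Ey.
have X0 : 0 < X by lra.
have tR i : 0 <= (t i)%:~R :> R by rewrite ler0z.
have C0 : 0 <= C X.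
  by apply: sumr_ge0 => i _; rewrite mulr_ge0 ?exprn_ge0// ltW.
have CYX : C Y <= C X.
  apply: ler_sum => i _; apply: ler_wpM2l => //.
  by rewrite lerXn2r ?nnegrE ?ltW.
have Bs : B Y <= Y / X * B X by apply: digit_series_scale => //; rewrite ltW.
have BX : 0 < B X.
  rewrite /B big_ltn// expr1 ltr_wpDr ?mulr_gt0 ?ltr0z//.
  by apply: sumr_ge0 => i _; rewrite mulr_ge0 ?exprn_ge0// ltW.
have BYX : B Y < B X.
  by apply: le_lt_trans Bs _; rewrite gtr_pMl// ltr_pdivrMr// mul1r.
have XP : X ^+ p.+1 < 1 by rewrite exprn_ilt1// ltW.
have YXP : Y ^+ p.+1 <= X ^+ p.+1 by rewrite lerXn2r ?nnegrE ?ltW.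
have XP' : 0 < 1 - X ^+ p.+1 by lra.
have BX1 : 0 <= 1 - B X by rewrite -(pmulr_rge0 _ XP') Ex.
have h1 : (1 - X ^+ p.+1) * (1 - B X) < (1 - X ^+ p.+1) * (1 - B Y).
  by rewrite ltr_pM2l//; lra.
have h2 : (1 - X ^+ p.+1) * (1 - B Y) <= (1 - Y ^+ p.+1) * (1 - B Y).
  by apply: ler_wpM2r; lra.
by move: (lt_le_trans h1 h2); rewrite Ex Ey ltNge CYX.
Qed.

(** Below degree [m] the coefficient is a difference of two digits, both in [0, beta]; the
    additional 1 is for degree [m], where -1 and a negated digit add up. *)
Lemma parry_mixed_coef_le t m p beta j :
  (forall i, 0 <= t i /\ (t i)%:~R <= beta) ->
  `|((parry_poly_mixed t m p)`_j)%:~R| <= beta + 1.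
Proof.
move=> tb; have [t00 t0b] := tb 0%N.
have b0 : 0 <= beta by rewrite (le_trans _ t0b)// ler0z.
rewrite parry_mixedE !(coefD, coefN, coefXn, coef_poly).
have [[u0 ub] [v0 vb]] := (tb (m + p.+1 - j)%N, tb (m - j)%N).
rewrite -(ler0z R) in u0; rewrite -(ler0z R) in v0.
have [jd|jd|jd] := ltngtP j (m + p.+1); have [jm|jm|jm] := ltngtP j m;
  rewrite ?addr0 ?add0r ?subr0 ?sub0r ?intrD ?intrN ?intrB ler_norml; try lra; try (exfalso; lia);
  rewrite /= ?mulr0n ?mulr1n; lra.
Qed.

End ParryPolynomial.

(** * Separability, complex roots and the Mahler measure *)

Section ComplexRoots.
Variable R : realType.

(** In characteristic 0 the derivative is nonzero of smaller degree, so [p] cannot divide it. *)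
Lemma irreducible_separable (p : {poly rat}) :
  irreducible_poly p -> separable_poly p.
Proof.
move=> [sz irr]; rewrite separable_poly.unlock /coprimep; apply/negPn/negP => g1.
have p0 : p != 0 by rewrite -size_poly_gt0 (ltn_trans _ sz).
have := irr _ g1 (dvdp_gcdl _ _); rewrite /eqp => /andP[_ pg].
have pd : p %| p^`() := dvdp_trans pg (dvdp_gcdr _ _).
have d0 : p^`() != 0.
  by rewrite -size_poly_gt0 size_deriv; case: (size p) sz => [|[]].
by have := dvdp_leq d0 pd; rewrite leqNgt lt_size_deriv.
Qed.

Lemma crootsE (q : {poly R[i]}) :
  q = lead_coef q *: \prod_(z <- croots q) ('X - z%:P).
Proof. exact: svalP (closed_field_poly_normal q). Qed.

Lemma croots_root (q : {poly R[i]}) z : q != 0 -> (z \in croots q) = root q z.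
Proof.
move=> q0; rewrite [in RHS](crootsE q) rootZ ?lead_coef_eq0//.
by rewrite root_prod_XsubC.
Qed.

Lemma croots_uniq (q : {poly R[i]}) : separable_poly q -> uniq (croots q).
Proof.
move=> sq; have q0 : q != 0 by apply: separable_poly_neq0.
rewrite -separable_prod_XsubC; apply: (dvdp_separable _ sq).
by rewrite [X in _ %| X](crootsE q) dvdpZr ?dvdpp// lead_coef_eq0.
Qed.

Lemma root_map_intr_complex (P : {poly int}) (x : R) :
  root (map_poly intr P : {poly R[i]}) (real_complex R x) =
  root (map_poly intr P) x.
Proof.
have -> : map_poly intr P = map_poly (real_complex R) (map_poly intr P).
  by rewrite -map_poly_comp; apply: eq_map_poly => n /=; rewrite rmorph_int.
by rewrite fmorph_root.
Qed.

Lemma root_map_ratr_complex (P : {poly rat}) (x : R) :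
  root (map_poly ratr P : {poly R[i]}) (real_complex R x) =
  root (map_poly ratr P) x.
Proof.
have -> : map_poly ratr P = map_poly (real_complex R) (map_poly ratr P).
  by rewrite -map_poly_comp; apply: eq_map_poly => n /=; rewrite fmorph_rat.
by rewrite fmorph_root.
Qed.

(** Separability turns the count with multiplicities among complex roots into a list of distinct
    real numbers. *)
Lemma positive_real_roots (P : {poly int}) :
  separable_poly (map_poly intr P : {poly rat}) ->
  exists v : seq R, [/\ size v = rp R P, uniq v,
    all (root (map_poly intr P)) v & all (fun x => 0 < x) v].
Proof.
move=> sP; set q : {poly R[i]} := map_poly intr P.
have sq : separable_poly q.
  have -> : q = map_poly ratr (map_poly intr P : {poly rat}).
    by rewrite -map_poly_comp; apply: eq_map_poly => n /=; rewrite rmorph_int.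
  by rewrite separable_map.
have q0 : q != 0 by apply: separable_poly_neq0.
pose a := fun z : R[i] => (complex.Im z == 0) && (0 < complex.Re z).
have aE z : a z -> z = real_complex R (complex.Re z).
  by case: z => x y /andP[/eqP /= -> _].
exists [seq complex.Re z | z <- croots q & a z]; split.
- by rewrite size_map size_filter.
- rewrite map_inj_in_uniq ?filter_uniq ?croots_uniq// => z z'.
  rewrite !mem_filter => /andP[/aE zE _] /andP[/aE zE' _] e.
  by rewrite zE [RHS]zE' e.
- rewrite all_map; apply/allP => z /=; rewrite mem_filter => /andP[/aE zE].
  by rewrite croots_root// [X in root _ X]zE root_map_intr_complex.
rewrite all_map; apply/allP => z /=; rewrite mem_filter => /andP[].
by case/andP.
Qed.

(** The root [x] contributes a factor at least [x], and all other factors are at least 1. *)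
Lemma root_le_mahler (P : {poly rat}) (x : R) : P \is monic ->
  root (map_poly ratr P) x -> x <= mahler R P.
Proof.
move=> mP rx; rewrite /mahler; set q := map_poly _ P.
have mq : q \is monic by apply: monic_map.
rewrite (monicP mq) ComplexField.Normc.normc1 mul1r.
have xq : real_complex R x \in croots q.
  by rewrite croots_root ?monic_neq0// root_map_ratr_complex.
pose N := ComplexField.Normc.normc (real_complex R x).
have xN : x <= N by rewrite /N /= expr0n /= addr0 sqrtr_sqr ler_norm.
apply: (@le_trans _ _ (Num.max 1 N)); first by rewrite le_max xN orbT.
rewrite (big_rem _ xq) /= -/N ler_peMr ?le_max ?ler01//.
apply: (big_ind (fun y => 1 <= y)) => // [y z|z _]; first exact: mulr_ege1.
by rewrite le_max lexx.
Qed.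

End ComplexRoots.

(** * Counting the positive roots of the Parry polynomial *)

Section PositiveRoots.
Variable R : realType.

Lemma mixed_positive_root_count (P : {poly int}) (beta : R) (v : seq R) n :
  irreducible_poly (map_poly intr P : {poly rat}) -> size P = n.+1 ->
  1 < beta -> (forall j, `|(P`_j)%:~R| <= beta + 1) ->
  {in v &, forall x y, 1 < x -> 1 < y -> x = y} ->
  uniq v -> all (root (map_poly intr P)) v -> all (fun x => 0 < x) v ->
  18 * ln (2 * n%:R * beta) <= n%:R ->
  (size v)%:R ^+ 2 <= 18 * n%:R * ln (2 * n%:R * beta).
Proof.
move=> [sP irr] szP b1 Pb v1 uv rv v0 nL; set L := 2 * n%:R * beta in nL *.
have szPr (F : numFieldType) : size (map_poly intr P : {poly F}) = n.+1.
  by rewrite size_map_inj_poly//; exact: intr_inj.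
have n0 : (0 < n)%N by move: sP; rewrite szPr.
have n1 : 1 <= n%:R :> R by rewrite ler1n.
have nL2 : 2 * n%:R <= L by rewrite ler_peMr ?(ltW b1) ?mulr_ge0.
have L2 : 2 <= L by lra.
have L4 := ln_ge4 L2 nL2 nL.
(* Otherwise X divides the irreducible polynomial, whose degree is then 1, against 18 ln L <= n and
   ln L >= 4. Being a nonzero integer, the constant coefficient has absolute value at least 1. *)
have P0 : P`_0 != 0.
  apply/eqP => P0.
  have /eqp_size : 'X %= (map_poly intr P : {poly rat}).
    apply: irr; rewrite ?size_polyX// -['X]subr0 -polyC0 dvdp_XsubCl.
    by rewrite rootE horner_coef0 coef_map_id0// P0.
  rewrite size_polyX szPr => -[/esym nE]; move: nL; rewrite nE /=; lra.
pose u := [seq x <- sort <=%R v | x <= 1].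
have vu : (size v <= (size u).+1)%N.
  rewrite /u size_filter -(size_sort <=%R v) -(count_predC (fun x => x <= 1)).
  rewrite -[leqRHS]addn1 leq_add2l -size_filter.
  set w := [seq x <- _ | _].
  have uw : uniq w by rewrite filter_uniq// sort_uniq.
  have w1 x : x \in w -> x \in v /\ 1 < x.
    by rewrite mem_filter mem_sort /= -ltNge => /andP[].
  case: w uw w1 => [|x [|y w]] //= /andP[xy _] w1; exfalso.
  have [xv x1] := w1 x (mem_head _ _).
  have [yv y1] : y \in v /\ 1 < y by apply: w1; rewrite !inE eqxx orbT.
  by move: xy; rewrite (v1 _ _ xv yv x1 y1) inE eqxx.
apply: (@le_trans _ _ ((size u).+1%:R ^+ 2)).
  by rewrite lerXn2r ?nnegrE ?ler0n// ler_nat.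
apply: (@small_root_count R (map_poly intr P)) => //.
- exact: szPr.
- by rewrite coef_map /= -intr_norm ler1z -gtz0_ge1 normr_gt0.
(* The sum is n (beta + 1), which is less than L = 2 n beta because beta > 1. *)
- rewrite szPr; apply: (@le_lt_trans _ _ (\sum_(1 <= j < n.+1) (beta + 1))).
    by apply: ler_sum => j _; rewrite coef_map /= Pb.
  rewrite sumr_const_nat subn1 /= -[_ *+ _]mulr_natr /L; nra.
- rewrite lt_sorted_uniq_le filter_uniq ?sort_uniq//=.
  by apply: sorted_filter; [exact: le_trans | exact/sort_sorted/le_total].
- by apply/allP => x; rewrite mem_filter mem_sort => /andP[_ /(allP rv)].
apply/allP => x; rewrite mem_filter mem_sort => /andP[-> /(allP v0) ->] //.
Qed.

Lemma parry_rp_bound (beta : R) (nb : {poly int}) :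
  1 < beta -> is_parry_poly beta nb ->
  irreducible_poly (map_poly intr nb : {poly rat}) ->
  (rp R nb)%:R ^+ 2 <=
    18 * (size nb).-1%:R * ln (2 * (size nb).-1%:R * beta).
Proof.
move=> b1 pb irr; set n := (size nb).-1.
have szP (F : numFieldType) : size (map_poly intr nb : {poly F}) = size nb.
  by rewrite size_map_inj_poly//; exact: intr_inj.
have sP : (1 < size nb)%N by case: irr; rewrite szP.
have szn : size nb = n.+1 by rewrite prednK// (ltn_trans _ sP).
have n1 : 1 <= n%:R :> R by rewrite ler1n; rewrite szn in sP.
have ln2 : 2^-1 <= ln (2 * n%:R * beta) by apply: ln_ge_half; nra.
have [v [<- uv rv v0]] := positive_real_roots R (irreducible_separable irr).
have tb i := parry_digit_itv i b1.
(* A single root is within the bound, whose right side is at least 9 since the logarithm is at least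
   1/2. *)
have one : {in v &, forall x y, x = y} ->
    (size v)%:R ^+ 2 <= 18 * n%:R * ln (2 * n%:R * beta).
  move=> v1; have : (size v <= 1)%N.
    case: v uv v1 {rv v0} => [|x [|y v]] //= /andP[xy _] v1.
    by move: xy; rewrite (v1 x y) ?inE ?eqxx ?orbT.
  rewrite -(ler_nat R) => h; have h0 : 0 <= (size v)%:R :> R by [].
  by rewrite expr2; nra.
case: pb irr szn szP rv => [m m0 _ _|m p _ _ m0|p _ _] irr szn szP rv.
- apply: one => x y xv yv; 
  apply: (@parry_finite_root_uniq R (parry_digit beta) m).
  + by move=> i _; case: (tb i).
  + exact: (allP v0).
  + exact: (allP v0).
  + exact: (allP rv).
  exact: (allP rv).
(* When n < 18 ln (2 n beta), the trivial count by the degree suffices: n^2 <= 18 n ln (2 n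
   beta). *)
- have [nL|nL] := lerP (18 * ln (2 * n%:R * beta)) n%:R.
    apply: (mixed_positive_root_count irr szn) => //.
      by move=> j; apply: parry_mixed_coef_le.
    move=> x y xv yv x1 y1.
    apply: (@parry_mixed_root_gt1_uniq R (parry_digit beta) m p) => //.
    + by move=> i; case: (tb i).
    + exact: parry_digit1_gt0.
    + exact: (allP rv).
    + exact: (allP rv).
  have : (size v)%:R <= n%:R :> R.
    rewrite ler_nat -ltnS -szn -(szP R) max_poly_roots//.
    by rewrite -size_poly_gt0 szP szn.
  have h0 : 0 <= (size v)%:R :> R by [].
  by rewrite expr2; nra.
apply: one => x y xv yv; rewrite parry_pureE in rv.
apply: (@parry_finite_root_uniq R _ p.+1); last 2 first.
- exact: (allP rv).
- exact: (allP rv).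
- by move=> i _; have [ti _] := tb i; case: ifP => // _; rewrite addr_ge0.
- exact: (allP v0).
exact: (allP v0).
Qed.

End PositiveRoots.

Theorem theorem3p23 (R : realType) (beta : R) (nb : {poly int})
    (Pb : {poly rat}) :
  parry_number beta ->
  is_parry_poly beta nb ->
  irreducible_poly (map_poly intr nb : {poly rat}) ->
  is_min_poly beta Pb ->
  let dP := (size nb).-1 in
  (rp R nb)%:R / dP%:R <=
    Num.sqrt (2 * pi / catalan R) *
    Num.sqrt (3 * ln (2 * dP%:R) + 4 * ln (mahler R Pb)) *
    (1 / Num.sqrt dP%:R) :> R.
Proof.
move=> [b1 _ _] pb irr [mP rb _]; cbv zeta; set dP := (size nb).-1.
have bound := parry_rp_bound b1 pb irr; rewrite -/dP in bound.
have d0 : (0 < dP)%N.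
  case: irr; rewrite size_map_inj_poly//; last exact: intr_inj.
  by rewrite /dP; case: (size nb) => [|[]].
have dR : 0 < dP%:R :> R by rewrite ltr0n.
have bM := root_le_mahler mP rb.
set M := mahler R Pb in bM *; set N := (rp R nb)%:R in bound *.
have lnb : ln beta <= ln M by rewrite ler_ln ?posrE//; lra.
have lnb0 : 0 <= ln beta by rewrite ln_ge0// ltW.
have lnd0 : 0 <= ln (2 * dP%:R) :> R.
  by rewrite ln_ge0// -natrM ler1n muln_gt0.
have lnE : ln (2 * dP%:R * beta) = ln (2 * dP%:R) + ln beta.
  by rewrite lnM ?posrE ?mulr_gt0//; lra.
set S := 3 * ln (2 * dP%:R) + 4 * ln M.
have S0 : 0 <= S by rewrite /S; lra.
have /andP[c89 c1] := catalan_itv R.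
have c0 : 0 < catalan R by lra.
have pc : 6 <= 2 * pi / catalan R.
  by rewrite ler_pdivlMr//; have := pi_ge3 R; nra.
set C := 2 * pi / catalan R in pc *.
have C0 : 0 <= C by lra.
have -> : Num.sqrt C * Num.sqrt S * (1 / Num.sqrt dP%:R)
    = Num.sqrt (C * S / dP%:R).
  by rewrite (sqrtrM _ (mulr_ge0 C0 S0)) (sqrtrM _ C0) sqrtrV ?ltW// mul1r.
(* Squaring reduces the claim to rp^2 <= C S d_P. The constant 18 of [parry_rp_bound] splits as 6 *
   3, with 6 <= C and 3 ln (2 d_P beta) <= S, the latter because 0 <= ln beta <= ln M. *)
rewrite -[leLHS]ger0_norm ?divr_ge0// -sqrtr_sqr ler_sqrt; last first.
  exact: (divr_ge0 (mulr_ge0 C0 S0) (ltW dR)).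
rewrite exprMn exprVn [dP%:R ^+ 2]expr2 invfM mulrA ler_pM2r ?invr_gt0//.
rewrite ler_pdivrMr// (le_trans bound)// lnE.
have : 3 * (ln (2 * dP%:R) + ln beta) <= S by rewrite /S; lra.
set Q := ln (2 * dP%:R) + ln beta => QS.
have : 6 * S <= C * S by rewrite ler_wpM2r.
have -> : 18 * dP%:R * Q = 6 * (3 * Q) * dP%:R by ring.
by move=> CS; rewrite ler_pM2r//; lra.
Qed.
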